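(* Let $k$ be a field, let $A$ be a $k$-algebra, let $H$ be a weak Hopf algebra over $k$ with bijective antipode $S$, and let $\rho\colon H\otimes A\to A$, written $h\cdot a:=\rho(h\otimes a)$, and $\varsigma\colon H\otimes H\to A$ be maps. Assume that for all $h,k,m\in H$ and $a,a'\in A$ the following conditions hold: (2) $h\cdot(aa')=(h^{(1)}\cdot a)(h^{(2)}\cdot a')$; (4) $1\cdot a=a$; (11) $h\cdot(k\cdot 1_A)=hk\cdot 1_A$; (17) $(h^{(1)}\cdot\varsigma(k^{(1)}\otimes m^{(1)}))\varsigma(h^{(2)}\otimes k^{(2)}m^{(2)})=\varsigma(h^{(1)}\otimes k^{(1)})\varsigma(h^{(2)}k^{(2)}\otimes m)$; (18) $(h^{(1)}\cdot(k^{(1)}\cdot a))\varsigma(h^{(2)}\otimes k^{(2)})=\varsigma(h^{(1)}\otimes k^{(1)})(h^{(2)}k^{(2)}\cdot a)$; (19) $\varsigma(h\otimes k)=\varsigma(h^{(1)}\otimes k^{(1)})(h^{(2)}k^{(2)}\cdot 1_A)$; (20) $h\cdot 1_A=(h^{(1)}\cdot(1^{(1)}\cdot 1_A))\varsigma(h^{(2)}\otimes 1^{(2)})$; (21) $h\cdot 1_A=(1^{(1)}\cdot 1_A)\varsigma(1^{(2)}\otimes h)$; (22) $a(1^{(1)}\cdot 1_A)\otimes 1^{(2)}=1^{(1)}\cdot a\otimes 1^{(2)}$ in $A\otimes H$. Then $\varsigma$ factorizes through a map $\sigma\colon H\otimes_{H^R}H\to A$, that is, $\varsigma=\sigma\circ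 p$ where $p\colon H\otimes H\to H\otimes_{H^R}H$ is the canonical surjection, and for all $h,k,m\in H$, $l\in H^L$ and $a,a'\in A$ the following hold: (1) $h\cdot 1_A=\Pi^L(h)\cdot 1_A$; (2) $h\cdot(aa')=(h^{(1)}\cdot a)(h^{(2)}\cdot a')$; (3) $S^{-1}(l)h\cdot a=(h\cdot a)(l\cdot 1_A)$ and $lh\cdot a=(l\cdot 1_A)(h\cdot a)$; (4) $1\cdot a=a$; (5) $\sigma(lh,k)=(l\cdot 1_A)\sigma(h,k)$ and $\sigma(S^{-1}(l)h,k)=\sigma(h,k)(l\cdot 1_A)$; (6) $(h^{(1)}\cdot(l\cdot 1_A))\sigma(h^{(2)},k)=\sigma(h,lk)$; (7) $\sigma(1,h)=\sigma(h,1)=h\cdot 1_A$; (8) $(h^{(1)}\cdot\sigma(k^{(1)},m^{(1)}))\sigma(h^{(2)},k^{(2)}m^{(2)})=\sigma(h^{(1)},k^{(1)})\sigma(h^{(2)}k^{(2)},m)$; (9) $(h^{(1)}\cdot(k^{(1)}\cdot a))\sigma(h^{(2)},k^{(2)})=\sigma(h^{(1)},k^{(1)})(h^{(2)}k^{(2)}\cdot a)$.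
   Context: Conventions: $\otimes=\otimes_k$, maps are $k$-linear, algebras are associative and unital. The Sweedler notation $\Delta(h)=h^{(1)}\otimes h^{(2)}$ (summation omitted) is used; in particular $\Delta(1)=1^{(1)}\otimes 1^{(2)}$, and primes denote a second copy of $\Delta(1)$. The expression $hk\cdot a$ means $(hk)\cdot a$. A weak bialgebra is a $k$-vector space $H$ with an algebra structure and a coalgebra structure (with comultiplication $\Delta$ and counit $\epsilon$) such that $\Delta(hl)=\Delta(h)\Delta(l)$, $\Delta^2(1)=1^{(1)}\otimes 1^{(2)}1^{(1')}\otimes 1^{(2')}=1^{(1)}\otimes 1^{(1')}1^{(2)}\otimes 1^{(2')}$ (where $\Delta^2=(\Delta\otimes \mathrm{id})\circ\Delta$), and $\epsilon(hlm)=\epsilon(hl^{(1)})\epsilon(l^{(2)}m)=\epsilon(hl^{(2)})\epsilon(l^{(1)}m)$ for all $h,l,m\in H$. Set $\Pi^L(h):=\epsilon(1^{(1)}h)1^{(2)}$ and $\Pi^R(h):=1^{(1)}\epsilon(h1^{(2)})$; these are idempotent maps $H\to H$, and their images $H^L:=\mathrm{Im}(\Pi^L)$ and $H^R:=\mathrm{Im}(\Pi^R)$ are subalgebras of $H$. An antipode is a map $S\colon H\to H$ with $h^{(1)}S(h^{(2)})=\Pi^L(h)$, $S(h^{(1)})h^{(2)}=\Pi^R(h)$ and $S(h^{(1)})h^{(2)}S(h^{(3)})=S(h)$ for all $h$; it is unique if it exists. A weak Hopf algebra is a weak bialgebra with an antipode. The tensor product $H\otimes_{H^R}H$ is formed using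 right and left multiplication by the subalgebra $H^R$, and $\sigma(h,k)$ stands for $\sigma(h\otimes_{H^R}k)$. *)

(* Defs.v *)
From HB Require Import structures.
From mathcomp Require Import all_boot all_order all_algebra.
From mathcomp Require Import boolp classical_sets.
From mathcomp Require Import freeg.

Set Implicit Arguments.
Unset Strict Implicit.
Unset Printing Implicit Defensive.

Import GRing.Theory.
Local Open Scope ring_scope.
Local Open Scope quotient_scope.

(* Associative unital k-algebras. The library's [algType] extends [nzRingType],
   hence excludes the zero algebra, and Hierarchy Builder does not allow a join
   of [lmodType] and [pzRingType] to be added below it; hence this record. *)
Record pzAlgType (k : fieldType) := PzAlg {
  pzAlg_ring : pzRingType;
  pzAlg_scale : k -> pzAlg_ring -> pzAlg_ring;
  pzAlg_scalerA : forall a b x,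
    pzAlg_scale a (pzAlg_scale b x) = pzAlg_scale (a * b) x;
  pzAlg_scale1r : left_id 1 pzAlg_scale;
  pzAlg_scalerDr : right_distributive pzAlg_scale +%R;
  pzAlg_scalerDl : forall x, {morph pzAlg_scale^~ x : a b / a + b};
  pzAlg_scalerAl : forall a x y, pzAlg_scale a (x * y) = pzAlg_scale a x * y;
  pzAlg_scalerAr : forall a x y, pzAlg_scale a (x * y) = x * pzAlg_scale a y
}.

Definition pzAlg_sort (k : fieldType) (A : pzAlgType k) : Type := pzAlg_ring A.
Coercion pzAlg_sort : pzAlgType >-> Sortclass.

HB.instance Definition _ (k : fieldType) (A : pzAlgType k) :=
  GRing.PzRing.on (pzAlg_sort A).
HB.instance Definition _ (k : fieldType) (A : pzAlgType k) :=
  GRing.Zmodule_isLmodule.Build k (pzAlg_sort A)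
    (@pzAlg_scalerA k A) (@pzAlg_scale1r k A)
    (@pzAlg_scalerDr k A) (@pzAlg_scalerDl k A).

(* An algebra used as a module is its canonical [lmodType] instance. *)
Coercion Defs_pzAlg_sort__canonical__GRing_Lmodule :
  pzAlgType >-> GRing.Lmodule.type.

Lemma pzscalerAl (k : fieldType) (A : pzAlgType k) (a : k) (x y : A) :
  a *: (x * y) = (a *: x) * y.
Proof. exact: pzAlg_scalerAl. Qed.

Lemma pzscalerAr (k : fieldType) (A : pzAlgType k) (a : k) (x y : A) :
  a *: (x * y) = x * (a *: y).
Proof. exact: pzAlg_scalerAr. Qed.

Section QuotientModule.
Variables (k : fieldType) (V : lmodType k) (S : set V).

Inductive lspan : V -> Prop :=
| Lspan0 : lspan 0
| LspanD (c : k) (u v : V) : S u -> lspan v -> lspan (c *: u + v).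

Definition in_lspan : {pred V} := fun v => `[< lspan v >].

Lemma lspanD u v : lspan u -> lspan v -> lspan (u + v).
Proof.
by move=> Su Sv; elim: Su => [|c x w Sx _ IH]; rewrite ?add0r // -addrA; apply: LspanD.
Qed.

Lemma lspanZ c u : lspan u -> lspan (c *: u).
Proof.
elim=> [|d x w Sx _ IH]; first by rewrite scaler0; exact: Lspan0.
by rewrite scalerDr scalerA; apply: LspanD.
Qed.

Lemma in_lspan_zmod_closed : zmod_closed in_lspan.
Proof.
split=> [|u v]; first by apply/asboolP; exact: Lspan0.
by move=> /asboolP Su /asboolP Sv; apply/asboolP/lspanD => //; rewrite -scaleN1r; apply: lspanZ.
Qed.

HB.instance Definition _ := GRing.isZmodClosed.Build V in_lspan in_lspan_zmod_closed.

Definition lquot := Quotient.quot in_lspan.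

HB.instance Definition _ := GRing.Zmodule.on lquot.

Definition lquot_proj (v : V) : lquot := \pi_(Quotient.quot in_lspan) v.
Definition lquot_repr (q : lquot) : V := repr q.

Lemma lquot_reprK : cancel lquot_repr lquot_proj.
Proof. by move=> q; exact: reprK. Qed.

Lemma lquot_projP u v : lquot_proj u = lquot_proj v <-> lspan (u - v).
Proof.
split=> [/eqP|]; last by move=> h; apply/eqP; rewrite -Quotient.idealrBE; apply/asboolP.
by rewrite -Quotient.idealrBE => /asboolP.
Qed.

Lemma lquot_projD : {morph lquot_proj : u v / u + v}.
Proof. by move=> u v; rewrite /lquot_proj piE. Qed.

Definition lquot_scale (c : k) (q : lquot) : lquot := lquot_proj (c *: lquot_repr q).

Lemma lquot_projZ c v : lquot_proj (c *: v) = lquot_scale c (lquot_proj v).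
Proof.
apply/lquot_projP; rewrite -scalerBr; apply: lspanZ.
by apply/lquot_projP; rewrite lquot_reprK.
Qed.

Lemma lquot_scaleA a b q : lquot_scale a (lquot_scale b q) = lquot_scale (a * b) q.
Proof. by rewrite -[q]lquot_reprK -!lquot_projZ scalerA. Qed.

Lemma lquot_scale1 : left_id 1 lquot_scale.
Proof. by move=> q; rewrite -[q]lquot_reprK -!lquot_projZ scale1r. Qed.

Lemma lquot_scaleDr : right_distributive lquot_scale +%R.
Proof.
move=> a q r; rewrite -[q]lquot_reprK -[r]lquot_reprK.
by rewrite -!lquot_projZ -!lquot_projD -!lquot_projZ scalerDr.
Qed.

Lemma lquot_scaleDl q : {morph lquot_scale^~ q : a b / a + b}.
Proof.
by move=> a b; rewrite -[q]lquot_reprK -!lquot_projZ -!lquot_projD scalerDl.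
Qed.

HB.instance Definition _ := GRing.Zmodule_isLmodule.Build k lquot
  lquot_scaleA lquot_scale1 lquot_scaleDr lquot_scaleDl.

Lemma lquot_proj_linear : linear lquot_proj.
Proof. by move=> a u v; rewrite lquot_projD lquot_projZ. Qed.

HB.instance Definition _ :=
  GRing.isLinear.Build k V lquot *:%R lquot_proj lquot_proj_linear.

End QuotientModule.

Section TensorProduct.
Variables (k : fieldType) (M N : lmodType k).

Local Notation F := {freeg (M * N)%type / k}.

Definition free_pair (m : M) (n : N) : F := Freeg [:: (1, (m, n))].

Inductive tensor_rel : F -> Prop :=
| TensorDl m m' n :
    tensor_rel (free_pair (m + m') n - free_pair m n - free_pair m' n)
| TensorDr m n n' :
    tensor_rel (free_pair m (n + n') - free_pair m n - free_pair m n')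
| TensorZl (c : k) m n :
    tensor_rel (free_pair (c *: m) n - c *: free_pair m n)
| TensorZr (c : k) m n :
    tensor_rel (free_pair m (c *: n) - c *: free_pair m n).

Definition tensor := lquot (tensor_rel : set F).
HB.instance Definition _ := GRing.Lmodule.on tensor.

Definition tens (m : M) (n : N) : tensor :=
  lquot_proj (tensor_rel : set F) (free_pair m n).

(* The linear map induced by a bilinear [f], computed on a chosen
   representative; it does not depend on that choice when [f] is bilinear. *)
Definition tlift (P : lmodType k) (t : tensor) (f : M -> N -> P) : P :=
  fglift (fun p => f p.1 p.2) (lquot_repr t).

End TensorProduct.

Notation "M ⊗ N" := (tensor M N) (at level 40, left associativity) : type_scope.
Notation "m ⊗ n" := (tens m n) (at level 40, left associativity) : ring_scope.

(* Sweedler notation: for [t] = Σ xᵢ ⊗ yᵢ and [E] bilinear in [x] and [y], this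
   is Σ E(xᵢ, yᵢ). *)
Notation "'\tsum_' ( x ⊗ y <- t ) E" := (tlift t (fun x y => E))
  (at level 41, x name, y name, t at level 200, E at level 41) : ring_scope.

Section TensorTheory.
Variables (k : fieldType) (M N : lmodType k).
Implicit Types (m : M) (n : N) (c : k).

Lemma fglift_linear (K : choiceType) (P : lmodType k) (f : K -> P) :
  linear (fglift f : {freeg K / k} -> P).
Proof.
have fgU (D : {freeg K / k}) : D = \sum_(z <- dom D) << coeff z D *g z >>.
  by rewrite freeg_sumE.
have addf : forall D E : {freeg K / k}, fglift f (D - E) = fglift f D - fglift f E.
  exact: lift_is_additive.
have f0 : fglift f (0 : {freeg K / k}) = 0 by rewrite -(subrr 0) addf subrr.
have addf' (D E : {freeg K / k}) : fglift f (D + E) = fglift f D + fglift f E.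
  by rewrite -[E]opprK addf -[in - - E](sub0r (- E)) addf f0 sub0r.
have sumf (I : Type) (r : seq I) (G : I -> {freeg K / k}) :
    fglift f (\sum_(i <- r) G i) = \sum_(i <- r) fglift f (G i).
  by elim/big_ind2: _ => // x1 x2 y1 y2 <- <-; rewrite addf'.
move=> a D E; rewrite addf'; congr (_ + _).
have -> : a *: D = \sum_(z <- dom D) << a * coeff z D *g z >> by [].
rewrite sumf (congr1 (fglift f) (fgU D)) sumf scaler_sumr; apply: eq_bigr => z _.
by rewrite !liftU scalerA.
Qed.

Lemma tensDl m m' n : (m + m') ⊗ n = m ⊗ n + m' ⊗ n.
Proof.
rewrite /tens -linearD; apply/lquot_projP; rewrite -[X in lspan _ X]addr0 opprD addrA.
by rewrite -[_ - _ - _]scale1r; apply: LspanD; [exact: TensorDl|exact: Lspan0].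
Qed.

Lemma tensDr m n n' : m ⊗ (n + n') = m ⊗ n + m ⊗ n'.
Proof.
rewrite /tens -linearD; apply/lquot_projP; rewrite -[X in lspan _ X]addr0 opprD addrA.
by rewrite -[_ - _ - _]scale1r; apply: LspanD; [exact: TensorDr|exact: Lspan0].
Qed.

Lemma tensZl c m n : (c *: m) ⊗ n = c *: (m ⊗ n).
Proof.
rewrite /tens -linearZ; apply/lquot_projP; rewrite -[X in lspan _ X]addr0.
by rewrite -[_ - _]scale1r; apply: LspanD; [exact: TensorZl|exact: Lspan0].
Qed.

Lemma tensZr c m n : m ⊗ (c *: n) = c *: (m ⊗ n).
Proof.
rewrite /tens -linearZ; apply/lquot_projP; rewrite -[X in lspan _ X]addr0.
by rewrite -[_ - _]scale1r; apply: LspanD; [exact: TensorZr|exact: Lspan0].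
Qed.

Lemma tens_ind (Q : M ⊗ N -> Prop) :
  Q 0 -> (forall m n t, Q t -> Q (m ⊗ n + t)) -> forall t, Q t.
Proof.
move=> Q0 QD t; rewrite -[t]lquot_reprK -[lquot_repr t]freeg_sumE linear_sum.
elim: (dom _) => [|[m n] r IH]; first by rewrite big_nil.
rewrite big_cons.
set c := coeff _ _; have -> : << c *g (m, n) >> = c *: free_pair m n.
  by apply/eqP/freeg_eqP => z; rewrite coeffZ !coeffU mul1r.
by rewrite linearZ -[X in Q (X + _)]tensZl; apply: QD.
Qed.

Section Lift.
Variables (P : lmodType k) (f : M -> N -> P).
Hypotheses (fl : forall n, linear (f^~ n)) (fr : forall m, linear (f m)).

Let g := fglift (fun p : M * N => f p.1 p.2).

Let g_lspan D : lspan (@tensor_rel k M N : set _) D -> g D = 0.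
Proof.
have gL := @fglift_linear (M * N)%type P (fun p => f p.1 p.2).
pose G : {linear {freeg (M * N)%type / k} -> P} :=
  HB.pack g (GRing.isLinear.Build k _ _ *:%R g gL).
have gU m n : G (free_pair m n) = f m n by rewrite /= /g liftU scale1r.
have fD1 n : {morph f^~ n : x y / x + y}.
  by move=> x y; rewrite -[x]scale1r fl !scale1r.
have fD2 m : {morph f m : x y / x + y}.
  by move=> x y; rewrite -[x]scale1r fr !scale1r.
have f01 n : f 0 n = 0 by apply: (@addrI _ (f 0 n)); rewrite -fD1 !addr0.
have f02 m : f m 0 = 0 by apply: (@addrI _ (f m 0)); rewrite -fD2 !addr0.
rewrite -[g]/(G : _ -> _); elim=> [|c u v Su _ IH]; first exact: linear0.
rewrite linearP IH addr0; suff -> : G u = 0 by rewrite scaler0.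
case: Su => [m m' n|m n n'|d m n|d m n];
  rewrite ?linearB ?linearZ ?gU.
- by rewrite fD1 -addrA -opprD subrr.
- by rewrite fD2 -addrA -opprD subrr.
- by rewrite /= scalerN -[d *: m]addr0 fl f01 addr0 subrr.
- by rewrite /= scalerN -[d *: n]addr0 fr f02 addr0 subrr.
Qed.

Let g_proj D : tlift (lquot_proj (@tensor_rel k M N : set _) D) f = g D.
Proof.
have gL := @fglift_linear (M * N)%type P (fun p => f p.1 p.2).
apply/eqP; rewrite -subr_eq0; apply/eqP.
rewrite /tlift -/g -[g D]scale1r -[in LHS]scaleN1r scale1r addrC -gL addrC.
by apply: g_lspan; rewrite scaleN1r; apply/lquot_projP; rewrite lquot_reprK.
Qed.

Lemma tlift_tens m n : tlift (m ⊗ n) f = f m n.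
Proof. by rewrite g_proj /g liftU scale1r. Qed.

Lemma tlift_linear : linear (fun t : M ⊗ N => tlift t f).
Proof.
move=> a s t; rewrite -[s]lquot_reprK -[t]lquot_reprK -linearP !g_proj.
exact: fglift_linear.
Qed.

End Lift.
End TensorTheory.

Section TensorAlgebra.
Variables (k : fieldType) (A B : pzAlgType k).

Definition tmul (s t : A ⊗ B) : A ⊗ B :=
  \tsum_(a ⊗ b <- s) \tsum_(a' ⊗ b' <- t) ((a * a') ⊗ (b * b')).

End TensorAlgebra.

(* Elements of H ⊗ H ⊗ H, such as Δ²(1), are written in H ⊗ (H ⊗ H), the
   associativity isomorphism being applied to (Δ ⊗ id) ∘ Δ. The counit takes
   values in [k^o], i.e. k as a module over itself, so [*:] between two of its
   values is the product of k. *)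
Record weakBialgType (k : fieldType) := WeakBialg {
  wb_alg :> pzAlgType k;
  comul : {linear wb_alg -> (wb_alg ⊗ wb_alg)%type};
  counit : {linear wb_alg -> k^o};
  comulA : forall h,
    \tsum_(x ⊗ y <- comul h) \tsum_(x1 ⊗ x2 <- comul x) (x1 ⊗ (x2 ⊗ y))
    = \tsum_(x ⊗ y <- comul h) (x ⊗ comul y);
  counitl : forall h, \tsum_(x ⊗ y <- comul h) (counit x *: y) = h;
  counitr : forall h, \tsum_(x ⊗ y <- comul h) (counit y *: x) = h;
  comulM : forall h l, comul (h * l) = tmul (comul h) (comul l);
  comul2_1 :
    \tsum_(x ⊗ y <- comul 1) \tsum_(x1 ⊗ x2 <- comul x) (x1 ⊗ (x2 ⊗ y))
    = \tsum_(x ⊗ y <- comul 1) \tsum_(x' ⊗ y' <- comul 1) (x ⊗ ((y * x') ⊗ y'));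
  comul2_1' :
    \tsum_(x ⊗ y <- comul 1) \tsum_(x1 ⊗ x2 <- comul x) (x1 ⊗ (x2 ⊗ y))
    = \tsum_(x ⊗ y <- comul 1) \tsum_(x' ⊗ y' <- comul 1) (x ⊗ ((x' * y) ⊗ y'));
  counitM : forall h l m,
    counit (h * l * m)
    = \tsum_(x ⊗ y <- comul l) (counit (h * x) *: counit (y * m));
  counitM' : forall h l m,
    counit (h * l * m)
    = \tsum_(x ⊗ y <- comul l) (counit (h * y) *: counit (x * m))
}.

Arguments comul {k w}.
Arguments counit {k w}.

Section WeakBialgebra.
Variables (k : fieldType) (H : weakBialgType k).

Definition PiL (h : H) : H := \tsum_(x ⊗ y <- comul 1) (counit (x * h) *: y).
Definition PiR (h : H) : H := \tsum_(x ⊗ y <- comul 1) (counit (h * y) *: x).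

Definition HL : set H := range PiL.
Definition HR : set H := range PiR.

End WeakBialgebra.

Arguments HL {k} H.
Arguments HR {k} H.

Record weakHopfType (k : fieldType) := WeakHopf {
  wh_bialg :> weakBialgType k;
  antipode : {linear wh_bialg -> wh_bialg};
  antipodel : forall h, \tsum_(x ⊗ y <- comul h) (x * antipode y) = PiL h;
  antipoder : forall h, \tsum_(x ⊗ y <- comul h) (antipode x * y) = PiR h;
  antipode_mid : forall h,
    \tsum_(x ⊗ y <- comul h) \tsum_(x1 ⊗ x2 <- comul x)
      (antipode x1 * x2 * antipode y) = antipode h
}.

Arguments antipode {k w}.

(* The tensor product of H with itself over a subalgebra B, as the quotient of
   the tensor product over k; [btensor_proj] is the canonical surjection. *)
Section BalancedTensor.
Variables (k : fieldType) (H : pzAlgType k) (B : set H).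

Definition btensor_rel : set (H ⊗ H) :=
  [set t | exists h b l, B b /\ t = (h * b) ⊗ l - h ⊗ (b * l)].

Definition btensor := lquot btensor_rel.
HB.instance Definition _ := GRing.Lmodule.on btensor.

Definition btensor_proj : {linear (H ⊗ H)%type -> btensor} :=
  lquot_proj btensor_rel.

End BalancedTensor.

Notation "h ⊗_[ B ] l" := (btensor_proj B (h ⊗ l))
  (at level 40, left associativity) : ring_scope.

(* Main.v *)
(* Applying functionals to (22) gives r · a = a (r · 1) for r in H^R, and, for
   a = h · 1, that h · 1 = (h₁ · 1)(Π^L(h₂) · 1), because
   1₁h ⊗ 1₂ = h₁ ⊗ Π^L(h₂). With Π^L(h₂) = h₂ S(h₃) and (11) the right-hand side
   collapses to Π^L(h) · 1, which is (1). Then (3) follows from the form of Δ on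
   H^L and H^R, since Π^L(S⁻¹(l)) = l and S⁻¹(l) lies in H^R. Finally (18) at
   a = 1 turns (19) into ς(h, k) = (h₁k₁ · 1) ς(h₂, k₂); expanding the arguments
   on the left or on the right by these two formulas gives (5), (6) and the
   H^R-balancedness of ς, and reduces (7) to (20) and (21). *)

From HB Require Import structures.
Require Import Defs.
From mathcomp Require Import all_boot all_order all_algebra.
From mathcomp Require Import boolp classical_sets.

Import GRing.Theory.
Local Open Scope ring_scope.

Set Implicit Arguments.
Unset Strict Implicit.

(** * Multilinear maps and automation of linearity proofs *)

Definition bilinear_map (k : fieldType) (M N P : lmodType k) (f : M -> N -> P) :=
  (forall n, linear (f^~ n)) /\ (forall m, linear (f m)).

Definition trilinear_map (k : fieldType) (L M N P : lmodType k)
    (f : L -> M -> N -> P) :=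
  [/\ forall m n, linear (fun x => f x m n), forall x n, linear (fun m => f x m n)
    & forall x m, linear (fun n => f x m n)].

Lemma linear_map0 (k : fieldType) (U V : lmodType k) (f : U -> V) : linear f -> f 0 = 0.
Proof. by move=> /(_ (-1) 0 0); rewrite scaleN1r oppr0 add0r scaleN1r addNr. Qed.

Lemma linear_mapD (k : fieldType) (U V : lmodType k) (f : U -> V) x y :
  linear f -> f (x + y) = f x + f y.
Proof. by move=> /(_ 1 x y); rewrite !scale1r. Qed.

Section LinearMaps.
Variables (k : fieldType) (U V W M N : lmodType k) (A : pzAlgType k).

Lemma linear_map_comp (g : V -> W) (f : U -> V) :
  linear g -> linear f -> linear (fun z => g (f z)).
Proof. by move=> lg lf a x y; rewrite lf lg. Qed.

Lemma linear_mulr (f : U -> A) (c : A) : linear f -> linear (fun z => f z * c).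
Proof. by move=> lf a x y; rewrite lf mulrDl pzscalerAl. Qed.

Lemma linear_mull (f : U -> A) (c : A) : linear f -> linear (fun z => c * f z).
Proof. by move=> lf a x y; rewrite lf mulrDr pzscalerAr. Qed.

Lemma linear_scalel (f : U -> k^o) (v : V) :
  linear f -> linear (fun z => (f z : k) *: v).
Proof. by move=> lf a x y; rewrite lf scalerDl scalerA. Qed.

Lemma linear_scaler (f : U -> V) (c : k) :
  linear f -> linear (fun z => c *: f z).
Proof. by move=> lf a x y; rewrite lf scalerDr !scalerA mulrC. Qed.

Lemma linear_tensl (f : U -> M) (n : N) : linear f -> linear (fun z => f z ⊗ n).
Proof. by move=> lf a x y; rewrite lf tensDl tensZl. Qed.

Lemma linear_tensr (f : U -> N) (m : M) : linear f -> linear (fun z => m ⊗ f z).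
Proof. by move=> lf a x y; rewrite lf tensDr tensZr. Qed.

Lemma linear_tlift_tensor (t : U -> (M ⊗ N)%type) (f : M -> N -> V) :
  linear t -> bilinear_map f -> linear (fun z => tlift (t z) f).
Proof. by move=> lt [fl fr] a x y; rewrite lt tlift_linear. Qed.

(** Induction on [t] as a sum of pure tensors, where the sum becomes [f z m n]. This covers a
    variable inside the summand; [linear_tlift_tensor] covers one inside the tensor. *)
Lemma linear_tlift_map (f : U -> M -> N -> V) (t : (M ⊗ N)%type) :
  (forall z, bilinear_map (f z)) -> (forall m n, linear (fun z => f z m n)) ->
  linear (fun z => tlift t (f z)).
Proof.
move=> bf lf a x y; elim/tens_ind: t => [|m n t IH].
  by rewrite !(fun z => linear_map0 (tlift_linear (bf z).1 (bf z).2)) scaler0 addr0.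
rewrite !(fun z => linear_mapD _ _ (tlift_linear (bf z).1 (bf z).2)).
by rewrite !(fun z => tlift_tens (bf z).1 (bf z).2) IH lf scalerDr addrACA.
Qed.

End LinearMaps.

Create HintDb linear_maps discriminated.

Ltac linear_head :=
  solve [ assumption | exact (@linearP _ _ _ _ _) | auto 1 with linear_maps nocore
        | match goal with
          | h : bilinear_map _ |- _ => first [apply (proj1 h) | apply (proj2 h)]
          | h : trilinear_map _ |- _ =>
              let h1 := fresh in let h2 := fresh in let h3 := fresh in
              destruct h as [h1 h2 h3]; first [apply h1 | apply h2 | apply h3]
          end ].

(* [match] rather than [lazymatch]: a pattern variable can capture the bound
   variable [z], in which case [apply] fails and the next branch is tried. *)
Ltac linear_step :=
  match goal with
  | |- GRing.linear_for _ (fun z => z) => exact (fun _ _ _ => erefl)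
  | |- GRing.linear_for _ (fun z => tlift (@?t z) ?f) =>
      apply (linear_tlift_tensor (t := t) (f := f))
  | |- GRing.linear_for _ (fun z => tlift ?t (fun x y => @?f z x y)) =>
      apply (linear_tlift_map (f := f) t)
  | |- GRing.linear_for _ (fun z => (@?f z) ⊗ ?n) => apply (linear_tensl (f := f) n)
  | |- GRing.linear_for _ (fun z => ?m ⊗ (@?f z)) => apply (linear_tensr (f := f) m)
  | |- GRing.linear_for _ (fun z => (@?f z) * ?c) => apply (linear_mulr (f := f) c)
  | |- GRing.linear_for _ (fun z => ?c * (@?f z)) => apply (linear_mull (f := f) c)
  | |- GRing.linear_for _ (fun z => (@?f z) *: ?v) => apply (linear_scalel (f := f) v)
  | |- GRing.linear_for _ (fun z => ?c *: (@?f z)) => apply (linear_scaler (f := f) c)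
  | |- GRing.linear_for _ (fun z => ?g (@?f z)) =>
      apply (linear_map_comp (g := g) (f := f)); [linear_head | ]
  | |- GRing.linear_for _ (fun z => ?g (@?f z) ?y) =>
      apply (linear_map_comp (g := fun w => g w y) (f := f)); [linear_head | ]
  | |- GRing.linear_for _ (fun z => ?g (@?f z) ?y ?w) =>
      apply (linear_map_comp (g := fun x => g x y w) (f := f)); [linear_head | ]
  | |- GRing.linear_for _ (fun z => ?g (@?f z) ?y ?w ?v) =>
      apply (linear_map_comp (g := fun x => g x y w v) (f := f)); [linear_head | ]
  end.

(** Recursion on the syntax of the map. A bare function is eta-expanded first, because [linear_step]
    matches abstractions only. *)
Ltac prove_linear :=
  cbv beta;
  lazymatch goal with
  | |- bilinear_map _ => split; prove_linear
  | |- trilinear_map _ => split; prove_linear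
  | |- GRing.linear_for _ (fun z => _) => linear_step; prove_linear
  | |- GRing.linear_for ?s ?f =>
      change (GRing.linear_for s (fun z => f z)); prove_linear
  | |- forall _, _ => intro; prove_linear
  end.

(** * Calculus of Sweedler sums *)

Section Sweedler.
Variable k : fieldType.

Lemma eq_tlift (M N P : lmodType k) (t : (M ⊗ N)%type) (f g : M -> N -> P) :
  (forall x y, f x y = g x y) -> tlift t f = tlift t g.
Proof. by move=> fg; congr (tlift t _); apply/funext => x; apply/funext. Qed.

Lemma tliftE (M N P : lmodType k) (m : M) (n : N) (f : M -> N -> P) :
  bilinear_map f -> tlift (m ⊗ n) f = f m n.
Proof. by move=> [fl fr]; apply: tlift_tens. Qed.

(** Pure tensors span, so this reduces the rules of the calculus to [tliftE]. *)
Lemma linear_tens_eq (M N P : lmodType k) (f g : (M ⊗ N)%type -> P) :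
  linear f -> linear g -> (forall x y, f (x ⊗ y) = g (x ⊗ y)) -> f =1 g.
Proof.
move=> lf lg fg; elim/tens_ind => [|m n t IH].
  by rewrite (linear_map0 lf) (linear_map0 lg).
by rewrite (linear_mapD _ _ lf) (linear_mapD _ _ lg) fg IH.
Qed.

Lemma tlift_id (M N : lmodType k) (t : (M ⊗ N)%type) : \tsum_(x ⊗ y <- t) (x ⊗ y) = t.
Proof.
by move: t; apply: linear_tens_eq => [||x y]; rewrite ?tliftE //; prove_linear.
Qed.

Lemma linear_tlift (M N P Q : lmodType k) (g : P -> Q) (t : (M ⊗ N)%type) (f : M -> N -> P) :
  linear g -> bilinear_map f -> g (tlift t f) = \tsum_(x ⊗ y <- t) g (f x y).
Proof.
move=> lg bf; move: t; apply: linear_tens_eq; try prove_linear.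
by move=> x y; rewrite !tliftE //; prove_linear.
Qed.

Lemma tlift_tlift (M N M' N' P : lmodType k) (t : (M ⊗ N)%type)
    (g : M -> N -> (M' ⊗ N')%type) (f : M' -> N' -> P) :
  bilinear_map g -> bilinear_map f ->
  tlift (tlift t g) f = \tsum_(x ⊗ y <- t) tlift (g x y) f.
Proof. move=> bg bf; apply: (linear_tlift (g := fun t => tlift t f)) => //; prove_linear. Qed.

Lemma exchange_tlift (M N M' N' P : lmodType k) (s : (M ⊗ N)%type) (t : (M' ⊗ N')%type)
    (f : M -> N -> M' -> N' -> P) :
  (forall u v, bilinear_map (fun x y => f x y u v)) ->
  (forall x y, bilinear_map (f x y)) ->
  \tsum_(x ⊗ y <- s) \tsum_(u ⊗ v <- t) f x y u v
  = \tsum_(u ⊗ v <- t) \tsum_(x ⊗ y <- s) f x y u v.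
Proof.
move=> b1 b2.
have l1 v x y : linear (fun u => f x y u v) by apply: (b2 x y).1.
have l2 u x y : linear (fun v => f x y u v) by apply: (b2 x y).2.
have l3 u v y : linear (fun x => f x y u v) by apply: (b1 u v).1.
have l4 u v x : linear (fun y => f x y u v) by apply: (b1 u v).2.
move: s; apply: linear_tens_eq; try prove_linear.
by move=> m n /=; rewrite tliftE; [apply: eq_tlift => u v /=; rewrite tliftE | prove_linear].
Qed.

Lemma tlift_tlift_tens (M N M' N' P : lmodType k) (t : (M ⊗ N)%type)
    (a : M -> N -> M') (b : M -> N -> N') (f : M' -> N' -> P) :
  bilinear_map (fun x y => a x y ⊗ b x y) -> bilinear_map f ->
  tlift (\tsum_(x ⊗ y <- t) (a x y ⊗ b x y)) f = \tsum_(x ⊗ y <- t) f (a x y) (b x y).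
Proof.
by move=> bab bf; rewrite tlift_tlift //; apply: eq_tlift => x y; rewrite tliftE.
Qed.

Lemma tlift_tens3 (L M N M' N' P : lmodType k) (t : (M' ⊗ N')%type)
    (a : M' -> N' -> (L ⊗ (M ⊗ N))%type) (f : L -> M -> N -> P) :
  bilinear_map a -> trilinear_map f ->
  \tsum_(x ⊗ w <- tlift t a) \tsum_(y ⊗ z <- w) f x y z
  = \tsum_(u ⊗ v <- t) \tsum_(x ⊗ w <- a u v) \tsum_(y ⊗ z <- w) f x y z.
Proof.
move=> ba tf; rewrite tlift_tlift //; prove_linear.
Qed.

Lemma tlift_tens3E (L M N P : lmodType k) (f : L -> M -> N -> P) x y z :
  trilinear_map f ->
  \tsum_(x ⊗ w <- x ⊗ (y ⊗ z)) \tsum_(y ⊗ z <- w) f x y z = f x y z.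
Proof. by move=> tf; rewrite !tliftE //; prove_linear. Qed.
End Sweedler.

(** * Weak bialgebras: Δ and the counital maps on H^L and H^R *)

Section WeakBialgebraTheory.
Variables (k : fieldType) (H : weakBialgType k).

Section Trilinear.
Variables (P : lmodType k) (f : H -> H -> H -> P).
Hypothesis tf : trilinear_map f.

(** The linear map on H ⊗ (H ⊗ H) induced by [f]. Applied to both sides of the axioms in H ⊗ (H ⊗
    H), it turns them into rewriting rules for sums with an arbitrary trilinear summand. *)
Let tlift3 (t : (H ⊗ (H ⊗ H))%type) :=
  \tsum_(x ⊗ w <- t) \tsum_(y ⊗ z <- w) f x y z.

Let tlift3_comul2 h :
  tlift3 (\tsum_(x ⊗ y <- comul h) \tsum_(x1 ⊗ x2 <- comul x) (x1 ⊗ (x2 ⊗ y)))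
  = \tsum_(x ⊗ y <- comul h) \tsum_(x1 ⊗ x2 <- comul x) f x1 x2 y.
Proof.
rewrite /tlift3 tlift_tens3; try prove_linear.
apply: eq_tlift => x y; rewrite tlift_tens3; try prove_linear.
by apply: eq_tlift => u v; rewrite tlift_tens3E.
Qed.

Lemma tlift_comulA h :
  \tsum_(x ⊗ y <- comul h) \tsum_(x1 ⊗ x2 <- comul x) f x1 x2 y
  = \tsum_(x ⊗ y <- comul h) \tsum_(y1 ⊗ y2 <- comul y) f x y1 y2.
Proof.
rewrite -tlift3_comul2 comulA /tlift3 tlift_tens3; try prove_linear.
by apply: eq_tlift => x y; rewrite tliftE //; prove_linear.
Qed.

Lemma tlift_comul2_1 :
  \tsum_(x ⊗ y <- comul 1) \tsum_(y1 ⊗ y2 <- comul y) f x y1 y2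
  = \tsum_(x ⊗ y <- comul (1 : H)) \tsum_(x' ⊗ y' <- comul 1) f x (y * x') y'.
Proof.
rewrite -tlift_comulA -tlift3_comul2 comul2_1 /tlift3 tlift_tens3; try prove_linear.
apply: eq_tlift => x y; rewrite tlift_tens3; try prove_linear.
by apply: eq_tlift => u v; rewrite tlift_tens3E.
Qed.

Lemma tlift_comul2_1' :
  \tsum_(x ⊗ y <- comul 1) \tsum_(y1 ⊗ y2 <- comul y) f x y1 y2
  = \tsum_(x ⊗ y <- comul (1 : H)) \tsum_(x' ⊗ y' <- comul 1) f x (x' * y) y'.
Proof.
rewrite -tlift_comulA -tlift3_comul2 comul2_1' /tlift3 tlift_tens3; try prove_linear.
apply: eq_tlift => x y; rewrite tlift_tens3; try prove_linear.
by apply: eq_tlift => u v; rewrite tlift_tens3E.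
Qed.

End Trilinear.

Lemma tlift_comulM (P : lmodType k) (f : H -> H -> P) (h l : H) : bilinear_map f ->
  \tsum_(x ⊗ y <- comul (h * l)) f x y
  = \tsum_(x ⊗ y <- comul h) \tsum_(u ⊗ v <- comul l) f (x * u) (y * v).
Proof.
move=> bf; rewrite comulM /tmul tlift_tlift; try prove_linear.
by apply: eq_tlift => x y; rewrite tlift_tlift_tens //; prove_linear.
Qed.

Lemma linear_PiL : linear (@PiL k H).
Proof. rewrite /PiL; prove_linear. Qed.

Lemma linear_PiR : linear (@PiR k H).
Proof. rewrite /PiR; prove_linear. Qed.

HB.instance Definition _ :=
  GRing.isLinear.Build k H H *:%R (@PiL k H) linear_PiL.
HB.instance Definition _ :=
  GRing.isLinear.Build k H H *:%R (@PiR k H) linear_PiR.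

#[local] Hint Resolve linear_PiL linear_PiR : linear_maps.

(** Exhibits Δ(Π^L(h)) as the image of Δ²(1) under ε(- h) on its first leg. The two forms of the
    unit axiom then put Π^L(h) to the left or to the right of 1₁. *)
Lemma comul_PiL_comul2 (h : H) :
  comul (PiL h) = \tsum_(x ⊗ y <- comul 1) \tsum_(y1 ⊗ y2 <- comul y)
    ((counit (x * h) : k) *: (y1 ⊗ y2 : (H ⊗ H)%type)).
Proof.
rewrite [LHS](linear_tlift (g := comul)); try prove_linear.
apply: eq_tlift => x y; rewrite linearZ /= -[in LHS](tlift_id (comul y)).
by rewrite (linear_tlift (g := fun t => _ *: t)) //; prove_linear.
Qed.

Lemma comul_PiR_comul2 (h : H) :
  comul (PiR h) = \tsum_(x ⊗ y <- comul 1) \tsum_(y1 ⊗ y2 <- comul y)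
    ((counit (h * y2) : k) *: (x ⊗ y1 : (H ⊗ H)%type)).
Proof.
rewrite -tlift_comulA; last by prove_linear.
rewrite [LHS](linear_tlift (g := comul)); try prove_linear.
apply: eq_tlift => x y; rewrite linearZ /= -[in LHS](tlift_id (comul x)).
by rewrite (linear_tlift (g := fun t => _ *: t)) //; prove_linear.
Qed.

Lemma comul_PiL (h : H) :
  comul (PiL h) = \tsum_(x ⊗ y <- comul 1) ((PiL h * x) ⊗ y).
Proof.
rewrite comul_PiL_comul2 tlift_comul2_1; last by prove_linear.
rewrite exchange_tlift; try prove_linear.
apply: eq_tlift => x y.
rewrite [RHS](linear_tlift (g := fun z : H => (z * x) ⊗ y)); try prove_linear.
by apply: eq_tlift => u v; rewrite -pzscalerAl tensZl.
Qed.

Lemma comul_PiL' (h : H) :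
  comul (PiL h) = \tsum_(x ⊗ y <- comul 1) ((x * PiL h) ⊗ y).
Proof.
rewrite comul_PiL_comul2 tlift_comul2_1'; last by prove_linear.
rewrite exchange_tlift; try prove_linear.
apply: eq_tlift => x y.
rewrite [RHS](linear_tlift (g := fun z : H => (x * z) ⊗ y)); try prove_linear.
by apply: eq_tlift => u v; rewrite -pzscalerAr tensZl.
Qed.

Lemma comul_PiR (h : H) :
  comul (PiR h) = \tsum_(x ⊗ y <- comul 1) (x ⊗ (y * PiR h)).
Proof.
rewrite comul_PiR_comul2 tlift_comul2_1; last by prove_linear.
apply: eq_tlift => x y.
rewrite [RHS](linear_tlift (g := fun z : H => x ⊗ (y * z))); try prove_linear.
by apply: eq_tlift => u v; rewrite -pzscalerAr tensZr.
Qed.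

Lemma comul_PiR' (h : H) :
  comul (PiR h) = \tsum_(x ⊗ y <- comul 1) (x ⊗ (PiR h * y)).
Proof.
rewrite comul_PiR_comul2 tlift_comul2_1'; last by prove_linear.
apply: eq_tlift => x y.
rewrite [RHS](linear_tlift (g := fun z : H => x ⊗ (z * y))); try prove_linear.
by apply: eq_tlift => u v; rewrite -pzscalerAl tensZr.
Qed.

Lemma tlift_comul_mul1 (P : lmodType k) (f : H -> H -> P) (h : H) : bilinear_map f ->
  \tsum_(u ⊗ v <- comul 1) \tsum_(x ⊗ y <- comul h) f (u * x) (v * y)
  = \tsum_(x ⊗ y <- comul h) f x y.
Proof. by move=> bf; rewrite -tlift_comulM // mul1r. Qed.

Lemma tlift_comul_1mul (P : lmodType k) (f : H -> H -> P) (h : H) : bilinear_map f ->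
  \tsum_(x ⊗ y <- comul h) \tsum_(u ⊗ v <- comul 1) f (x * u) (y * v)
  = \tsum_(x ⊗ y <- comul h) f x y.
Proof. by move=> bf; rewrite -tlift_comulM // mulr1. Qed.

(** Multiply Δ(l) = l1₁ ⊗ 1₂ by Δ(h) and absorb Δ(1) into Δ(h). The two lemmas for H^R follow the
    same pattern. *)
Lemma comul_HL_mul (l h : H) : HL H l ->
  comul (l * h) = \tsum_(x ⊗ y <- comul h) ((l * x) ⊗ y).
Proof.
move=> [l' _ <-]; rewrite -[LHS]tlift_id tlift_comulM; last by prove_linear.
rewrite comul_PiL tlift_tlift_tens; try prove_linear.
rewrite -[RHS]tlift_comul_mul1; last by prove_linear.
by apply: eq_tlift => u v; apply: eq_tlift => x y; rewrite mulrA.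
Qed.

Lemma comul_HR_mul (r h : H) : HR H r ->
  comul (r * h) = \tsum_(x ⊗ y <- comul h) (x ⊗ (r * y)).
Proof.
move=> [r' _ <-]; rewrite -[LHS]tlift_id tlift_comulM; last by prove_linear.
rewrite comul_PiR' tlift_tlift_tens; try prove_linear.
rewrite -[RHS]tlift_comul_mul1; last by prove_linear.
by apply: eq_tlift => u v; apply: eq_tlift => x y; rewrite mulrA.
Qed.

Lemma comul_mul_HR (h r : H) : HR H r ->
  comul (h * r) = \tsum_(x ⊗ y <- comul h) (x ⊗ (y * r)).
Proof.
move=> [r' _ <-]; rewrite -[LHS]tlift_id tlift_comulM; last by prove_linear.
rewrite -[RHS]tlift_comul_1mul; last by prove_linear.
apply: eq_tlift => u v; rewrite comul_PiR tlift_tlift_tens; try prove_linear.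
by apply: eq_tlift => x y; rewrite mulrA.
Qed.

(** The left side is h₁ ⊗ ε(1₁'h₂)1₂'. Putting Δ(1) in front of Δ(h) gives 1₁h₁ ⊗ ε(1₁'1₂h₂)1₂',
    which the unit axiom turns into 1₁h₁ε(1₂h₂) ⊗ 1₃; the counit contracts this. *)
Lemma comul_idPiL (h : H) :
  \tsum_(x ⊗ y <- comul h) (x ⊗ PiL y) = \tsum_(u ⊗ v <- comul 1) ((u * h) ⊗ v).
Proof.
transitivity (\tsum_(u' ⊗ v' <- comul 1) \tsum_(x ⊗ y <- comul h)
    (((counit (u' * y) : k) *: x) ⊗ v')).
  rewrite exchange_tlift; try prove_linear.
  apply: eq_tlift => x y; rewrite [LHS](linear_tlift (g := tens x)); try prove_linear.
  by apply: eq_tlift => u v; rewrite tensZl tensZr.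
transitivity (\tsum_(u ⊗ v <- comul 1) \tsum_(u' ⊗ v' <- comul 1)
    \tsum_(x ⊗ y <- comul h) (((counit (u' * v * y) : k) *: (u * x)) ⊗ v')).
  rewrite [RHS]exchange_tlift; try prove_linear.
  apply: eq_tlift => u' v'; rewrite -tlift_comul_mul1; last by prove_linear.
  by do 2![apply: eq_tlift => ? ?]; rewrite mulrA.
rewrite -[LHS](tlift_comul2_1' (f := fun u v w => \tsum_(x ⊗ y <- comul h)
    (((counit (v * y) : k) *: (u * x)) ⊗ w))); last by prove_linear.
rewrite -tlift_comulA; last by prove_linear.
apply: eq_tlift => u v; rewrite -[in RHS](counitr (u * h)).
rewrite [RHS](linear_tlift (g := fun z : H => z ⊗ v)); try prove_linear.
by rewrite tlift_comulM //; prove_linear.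
Qed.

(** Apply ε to the middle leg of the unit axiom with 1₁'1₂ in the middle. *)
Lemma comul1_PiR : \tsum_(x ⊗ y <- comul 1) (PiR x ⊗ y) = comul (1 : H).
Proof.
transitivity (\tsum_(x ⊗ y <- comul 1) \tsum_(x' ⊗ y' <- comul (1 : H))
    (((counit (x' * y) : k) *: x) ⊗ y')).
  rewrite [RHS]exchange_tlift; try prove_linear.
  apply: eq_tlift => x y; rewrite [LHS](linear_tlift (g := fun z : H => z ⊗ y)) //.
    prove_linear.
  prove_linear.
rewrite -[LHS](tlift_comul2_1' (f := fun u v w => ((counit v : k) *: u) ⊗ w)).
  rewrite -tlift_comulA; last by prove_linear.
  rewrite -[RHS]tlift_id; apply: eq_tlift => x y; rewrite -[in RHS](counitr x).
  by rewrite [RHS](linear_tlift (g := fun z : H => z ⊗ y)) //; prove_linear.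
prove_linear.
Qed.

Lemma comul1_PiL : \tsum_(x ⊗ y <- comul 1) (x ⊗ PiL y) = comul (1 : H).
Proof.
by rewrite comul_idPiL -[RHS]tlift_id; apply: eq_tlift => x y; rewrite mulr1.
Qed.

Lemma PiL_id (h : H) : PiL (PiL h) = PiL h.
Proof.
rewrite [in RHS]/PiL -[in RHS]comul1_PiL tlift_tlift_tens; try prove_linear.
rewrite [LHS](linear_tlift (g := @PiL k H)); try prove_linear.
by apply: eq_tlift => x y; rewrite linearZ.
Qed.

Lemma PiL_HL (l : H) : HL H l -> PiL l = l.
Proof. by move=> [h _ <-]; exact: PiL_id. Qed.

Lemma HL_PiL_HR (l : H) : HL H l -> exists2 r, HR H r & PiL r = l.
Proof.
(* The witness 1₁ε(1₂l) turns out to be S⁻¹(l). *)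
move=> Hl; exists (\tsum_(x ⊗ y <- comul 1) ((counit (y * l) : k) *: x)).
  (* The witness is its own preimage: Π^R fixes it by [comul1_PiR]. *)
  exists (\tsum_(x ⊗ y <- comul 1) ((counit (y * l) : k) *: x)) => //.
  rewrite [LHS](linear_tlift (g := @PiR k H)); try prove_linear.
  rewrite -[in RHS]comul1_PiR tlift_tlift_tens; try prove_linear.
  by apply: eq_tlift => x y; rewrite linearZ.
rewrite -[RHS](PiL_HL Hl) (linear_tlift (g := @PiL k H)); try prove_linear.
transitivity (\tsum_(x ⊗ y <- comul 1) \tsum_(u ⊗ v <- comul (1 : H))
    ((counit (u * x) *: counit (y * l) : k) *: v)).
  apply: eq_tlift => x y; rewrite linearZ /= [in LHS]/PiL.
  rewrite (linear_tlift (g := fun z : H => (counit (y * l) : k) *: z)); try prove_linear.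
  by apply: eq_tlift => u v; rewrite scalerA mulrC.
rewrite exchange_tlift; try prove_linear.
(* The weak multiplicativity of ε with middle factor 1: ε(u1₁)ε(1₂l) = ε(ul). *)
apply: eq_tlift => u v; rewrite -[in RHS](mulr1 u) counitM.
by rewrite (linear_tlift (g := fun c : k^o => (c : k) *: v)) //; prove_linear.
Qed.
End WeakBialgebraTheory.

#[export] Hint Resolve linear_PiL linear_PiR : linear_maps.

(** * The antipode on H^R and its inverse on H^L *)

Section WeakHopfTheory.
Variables (k : fieldType) (H : weakHopfType k).

Lemma antipode_HR (r : H) : HR H r -> antipode r = PiL r.
Proof.
move=> Hr; have comul_r : comul r = \tsum_(x ⊗ y <- comul 1) (x ⊗ (r * y)).
  by rewrite -comul_HR_mul ?mulr1.
rewrite -antipode_mid -antipodel.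
transitivity (\tsum_(x ⊗ y <- comul r) (PiR x * antipode y)).
  apply: eq_tlift => x y; rewrite -antipoder.
  by rewrite (linear_tlift (g := fun z : H => z * antipode y)) //; prove_linear.
rewrite comul_r !tlift_tlift_tens; try prove_linear.
rewrite -[in RHS]comul1_PiR tlift_tlift_tens //; prove_linear.
Qed.

(** Some r in H^R has l = Π^L(r) = S(r), so S⁻¹(l) is that r. *)
Lemma Sinv_HL (Sinv : H -> H) (l : H) :
  cancel (antipode : H -> H) Sinv -> HL H l ->
  HR H (Sinv l) /\ PiL (Sinv l) = l.
Proof. by move=> SK /HL_PiL_HR [r Hr <-]; rewrite -{1 2}(antipode_HR Hr) SK. Qed.

End WeakHopfTheory.

(** Provides σ: since [f] kills the span of [R], its value on the chosen representative depends
    linearly on the class. *)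
Lemma linear_lquot_lift (k : fieldType) (V P : lmodType k) (R : set V)
    (f : {linear V -> P}) :
  (forall v, R v -> f v = 0) ->
  exists g : {linear lquot R -> P}, forall v, f v = g (lquot_proj R v).
Proof.
move=> fR; have f0 v : lspan R v -> f v = 0.
  by elim=> [|c u w /fR fu _ fw]; rewrite ?linear0 // linearP fu fw scaler0 add0r.
have fE v : f v = f (lquot_repr (lquot_proj R v)).
  apply/esym/eqP; rewrite -subr_eq0 -linearB; apply/eqP/f0.
  by apply/lquot_projP; rewrite lquot_reprK.
have gL : linear (fun q : lquot R => f (lquot_repr q)).
  by move=> a p q; rewrite -[p]lquot_reprK -[q]lquot_reprK -linearP -!fE linearP.
pose g : {linear lquot R -> P} :=
  HB.pack (fun q : lquot R => f (lquot_repr q)) (GRing.isLinear.Build k _ _ *:%R _ gL).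
by exists g.
Qed.

(** * The action of H^L and H^R on A *)

Section MeasuringAction.
Variables (k : fieldType) (A : pzAlgType k) (H : weakHopfType k).
Variable rho : {linear (H ⊗ A)%type -> A}.

Local Notation "h ▷ a" := (rho (@tens k H A h a)) (at level 35, right associativity).

Hypothesis actM : forall (h : H) (a b : A),
  h ▷ (a * b) = \tsum_(x ⊗ y <- comul h) ((x ▷ a) * (y ▷ b)).
Hypothesis act1 : forall a : A, (1 : H) ▷ a = a.
Hypothesis act_act1 : forall h g : H, h ▷ g ▷ (1 : A) = (h * g) ▷ (1 : A).
Hypothesis act_comul1 : forall a : A,
  \tsum_(u ⊗ v <- comul (1 : H)) ((a * (u ▷ (1 : A))) ⊗ v)
  = \tsum_(u ⊗ v <- comul (1 : H)) ((u ▷ a) ⊗ v).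

Lemma tlift_act_comul1 (P : lmodType k) (f : A -> H -> P) (a : A) : bilinear_map f ->
  \tsum_(u ⊗ v <- comul 1) f (a * (u ▷ 1)) v = \tsum_(u ⊗ v <- comul 1) f (u ▷ a) v.
Proof.
move=> bf; have := congr1 (fun t => tlift t f) (act_comul1 a).
by rewrite !tlift_tlift_tens //; prove_linear.
Qed.

(** For r = Π^R(h), the functional ε(h -) on the second leg of [act_comul1] turns the first leg into
    r. *)
Lemma act_HR (r : H) (a : A) : HR H r -> r ▷ a = a * (r ▷ 1).
Proof.
move=> [h _ <-].
rewrite [in LHS](linear_tlift (g := fun z : H => z ▷ a)); try prove_linear.
rewrite [in RHS](linear_tlift (g := fun z : H => a * (z ▷ 1))); try prove_linear.
transitivity (\tsum_(u ⊗ v <- comul 1) ((counit (h * v) : k) *: (u ▷ a))).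
  by apply: eq_tlift => u v; rewrite tensZl linearZ.
rewrite -[LHS](tlift_act_comul1 (f := fun b v => (counit (h * v) : k) *: b)).
  by apply: eq_tlift => u v; rewrite tensZl linearZ /= pzscalerAr.
prove_linear.
Qed.

Lemma mul_act_comul1 (h : H) (a b : A) :
  \tsum_(u ⊗ v <- comul h) (a * (u ▷ 1) * (v ▷ b)) = a * (h ▷ b).
Proof.
rewrite -[b in RHS]mul1r actM (linear_tlift (g := fun z : A => a * z)); try prove_linear.
by apply: eq_tlift => u v; rewrite mulrA.
Qed.

Lemma act1_PiL (h : H) : h ▷ 1 = PiL h ▷ 1.
Proof.
transitivity (\tsum_(x ⊗ y <- comul h) ((x ▷ 1) * (PiL y ▷ 1))).
  (* Expand (h·1)(1·1) along Δ(1) and let [act_comul1] move 1₁ onto h·1; this gives (1₁h·1)(1₂·1),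
     to which [comul_idPiL] applies. *)
  rewrite -[LHS]mulr1 -[X in _ * X]act1 -mul_act_comul1.
  rewrite (tlift_act_comul1 (f := fun b v => b * (v ▷ 1))); try prove_linear.
  have := congr1 (fun t => \tsum_(x ⊗ y <- t) ((x ▷ 1) * (y ▷ 1))) (comul_idPiL h).
  rewrite !tlift_tlift_tens; try prove_linear.
  by move=> ->; apply: eq_tlift => u v; rewrite act_act1.
transitivity (\tsum_(x ⊗ y <- comul h) \tsum_(y1 ⊗ y2 <- comul y)
    ((x ▷ 1) * (y1 ▷ antipode y2 ▷ 1))).
  apply: eq_tlift => x y; rewrite -antipodel.
  rewrite (linear_tlift (g := fun z : H => (x ▷ 1) * (z ▷ 1))); try prove_linear.
  by apply: eq_tlift => y1 y2; rewrite act_act1.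
(* Regrouping the first two legs lets [actM] contract (h₁·1)(h₂·(S(h₃)·1)) to h₁·(S(h₂)·1). *)
rewrite -tlift_comulA; last by prove_linear.
rewrite -[in RHS]antipodel (linear_tlift (g := fun z : H => z ▷ 1)); try prove_linear.
by apply: eq_tlift => x y; rewrite -actM mul1r act_act1.
Qed.

(** Both sides equal (1₁·(l·1))(1₂·a): the left one by Δ(l) = 1₁l ⊗ 1₂ and [act_act1], the right one
    by [act_comul1]. *)
Lemma act_HL (l : H) (a : A) : HL H l -> l ▷ a = (l ▷ 1) * a.
Proof.
case=> h _ <- {l}; set l := PiL h.
rewrite -[in LHS](mul1r a) actM comul_PiL' tlift_tlift_tens; try prove_linear.
rewrite -[in RHS](act1 a) -mul_act_comul1.
rewrite [RHS](tlift_act_comul1 (f := fun b v => b * (v ▷ a))); try prove_linear.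
by apply: eq_tlift => u v; rewrite act_act1.
Qed.

(** [act_act1] concerns the unit only, so a is written 1a, and Δ(lh) = lh₁ ⊗ h₂ places l on the
    factor 1. For H^R, a is written a1 and Δ(rh) = h₁ ⊗ rh₂ is used. *)
Lemma act_HL_mul (l h : H) (a : A) : HL H l -> (l * h) ▷ a = (l ▷ 1) * (h ▷ a).
Proof.
move=> Hl; rewrite -[in LHS](mul1r a) actM comul_HL_mul // tlift_tlift_tens; try prove_linear.
rewrite -mul_act_comul1; apply: eq_tlift => x y.
by rewrite -act_act1 (act_HL _ Hl).
Qed.

Lemma act_HR_mul (r h : H) (a : A) : HR H r -> (r * h) ▷ a = (h ▷ a) * (r ▷ 1).
Proof.
move=> Hr; rewrite -[in LHS](mulr1 a) actM comul_HR_mul // tlift_tlift_tens; try prove_linear.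
rewrite -[in RHS](mulr1 a) actM (linear_tlift (g := fun z : A => z * (r ▷ 1))); try prove_linear.
by apply: eq_tlift => x y; rewrite -act_act1 (act_HR _ Hr) mulrA.
Qed.

(** * The cocycle under multiplication by H^L and H^R *)

Section Cocycle.
Variable varsigma : {linear (H ⊗ H)%type -> A}.

Local Notation s h g := (varsigma (@tens k H H h g)).

Hypothesis twisted1 : forall h g : H,
  \tsum_(x ⊗ y <- comul h) \tsum_(u ⊗ v <- comul g) ((x ▷ u ▷ 1) * s y v)
  = \tsum_(x ⊗ y <- comul h) \tsum_(u ⊗ v <- comul g) (s x u * ((y * v) ▷ 1)).
Hypothesis cocycle_absorbr : forall h g : H,
  s h g = \tsum_(x ⊗ y <- comul h) \tsum_(u ⊗ v <- comul g) (s x u * ((y * v) ▷ 1)).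

Lemma cocycle_absorbl (h g : H) :
  s h g = \tsum_(x ⊗ y <- comul h) \tsum_(u ⊗ v <- comul g) ((x ▷ u ▷ 1) * s y v).
Proof. by rewrite twisted1. Qed.

(** Both sides expand to ς(h₁, g₁)(h₂rg₂·1), as Δ(hr) = h₁ ⊗ h₂r and Δ(rg) = g₁ ⊗ rg₂. *)
Lemma cocycle_balanced (h r g : H) : HR H r -> s (h * r) g = s h (r * g).
Proof.
move=> Hr; rewrite [LHS]cocycle_absorbr [RHS]cocycle_absorbr.
rewrite comul_mul_HR // tlift_tlift_tens; try prove_linear.
apply: eq_tlift => x y; rewrite comul_HR_mul // tlift_tlift_tens; try prove_linear.
by apply: eq_tlift => u v; rewrite mulrA.
Qed.

(** In Δ(lh) the factor l sits on the first leg, so the left expansion puts it inside the action,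
    where [act_HL_mul] extracts it. An r in H^R sits on the second leg, hence the right expansion in
    the next lemma. *)
Lemma cocycle_HL_mul (l h g : H) : HL H l -> s (l * h) g = (l ▷ 1) * s h g.
Proof.
move=> Hl; rewrite [LHS]cocycle_absorbl [in RHS]cocycle_absorbl.
rewrite comul_HL_mul // tlift_tlift_tens; try prove_linear.
rewrite (linear_tlift (g := fun z : A => (l ▷ 1) * z)); try prove_linear.
apply: eq_tlift => x y.
rewrite (linear_tlift (g := fun z : A => (l ▷ 1) * z)); try prove_linear.
by apply: eq_tlift => u v; rewrite act_HL_mul // mulrA.
Qed.

Lemma cocycle_HR_mul (r h g : H) : HR H r -> s (r * h) g = s h g * (r ▷ 1).
Proof.
move=> Hr; rewrite [LHS]cocycle_absorbr [in RHS]cocycle_absorbr.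
rewrite comul_HR_mul // tlift_tlift_tens; try prove_linear.
rewrite (linear_tlift (g := fun z : A => z * (r ▷ 1))); try prove_linear.
apply: eq_tlift => x y.
rewrite (linear_tlift (g := fun z : A => z * (r ▷ 1))); try prove_linear.
by apply: eq_tlift => u v; rewrite -[r * y * v]mulrA act_HR_mul // mulrA.
Qed.

(** The left expansion of the right side is (h₁·((l·1)(g₁·1)))ς(h₂, g₂). Distributing h₁ by [actM]
    produces the left expansion of ς(h₂, g) inside the sum. *)
Lemma cocycle_mul_HL (h l g : H) : HL H l ->
  \tsum_(x ⊗ y <- comul h) ((x ▷ l ▷ 1) * s y g) = s h (l * g).
Proof.
move=> Hl; rewrite [RHS]cocycle_absorbl comul_HL_mul //.
transitivity (\tsum_(x ⊗ y <- comul h) \tsum_(y1 ⊗ y2 <- comul y) \tsum_(u ⊗ v <- comul g)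
    ((x ▷ l ▷ 1) * ((y1 ▷ u ▷ 1) * s y2 v))).
  apply: eq_tlift => x y; rewrite [in LHS]cocycle_absorbl.
  rewrite (linear_tlift (g := fun z : A => (x ▷ l ▷ 1) * z)); try prove_linear.
  apply: eq_tlift => y1 y2.
  by rewrite (linear_tlift (g := fun z : A => (x ▷ l ▷ 1) * z)) //; prove_linear.
rewrite -tlift_comulA; last by prove_linear.
apply: eq_tlift => x y; rewrite tlift_tlift_tens; try prove_linear.
rewrite exchange_tlift; try prove_linear.
apply: eq_tlift => u v; rewrite act_HL_mul // actM.
rewrite [RHS](linear_tlift (g := fun z : A => z * s y v)); try prove_linear.
by apply: eq_tlift => x1 x2; rewrite mulrA.
Qed.

(** Replacing 1₂ by Π^L(1₂) lets it leave the cocycle as a factor. [act1_PiL] then removes Π^L, and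
    (1₁·1)(1₂·1) = 1. *)
Lemma cocycle_1l (h : H) :
  \tsum_(u ⊗ v <- comul 1) ((u ▷ 1) * s v h) = s 1 h.
Proof.
rewrite -comul1_PiL tlift_tlift_tens; try prove_linear.
transitivity (\tsum_(u ⊗ v <- comul 1) ((u ▷ 1) * (PiL v ▷ 1) * s 1 h)).
  by apply: eq_tlift => u v; rewrite -[PiL v in LHS]mulr1 cocycle_HL_mul ?mulrA; last exists v.
transitivity (\tsum_(u ⊗ v <- comul 1) (1 * (u ▷ 1) * (v ▷ 1) * s 1 h)).
  by apply: eq_tlift => u v; rewrite -act1_PiL mul1r.
rewrite -[LHS](linear_tlift (g := fun z : A => z * s 1 h)); try prove_linear.
by rewrite mul_act_comul1 act1 !mul1r.
Qed.

End Cocycle.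
End MeasuringAction.

(** * Construction of σ and verification of its properties *)

Theorem theorem2p3 (k : fieldType) (A : pzAlgType k) (H : weakHopfType k)
  (Sinv : H -> H)
  (SK : cancel (antipode : H -> H) Sinv) (KS : cancel Sinv (antipode : H -> H))
  (rho : {linear (H ⊗ A)%type -> A})
  (varsigma : {linear (H ⊗ H)%type -> A})
  (h2 : forall (h : H) (a a' : A),
    rho (h ⊗ (a * a'))
    = \tsum_(x ⊗ y <- comul h) (rho (x ⊗ a) * rho (y ⊗ a')))
  (h4 : forall a : A, rho ((1 : H) ⊗ a) = a)
  (h11 : forall h g : H, rho (h ⊗ rho (g ⊗ (1 : A))) = rho ((h * g) ⊗ (1 : A)))
  (h17 : forall h g m : H,
    \tsum_(x ⊗ y <- comul h) \tsum_(u ⊗ v <- comul g) \tsum_(p ⊗ q <- comul m)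
      (rho (x ⊗ varsigma (u ⊗ p)) * varsigma (y ⊗ (v * q)))
    = \tsum_(x ⊗ y <- comul h) \tsum_(u ⊗ v <- comul g)
      (varsigma (x ⊗ u) * varsigma ((y * v) ⊗ m)))
  (h18 : forall (h g : H) (a : A),
    \tsum_(x ⊗ y <- comul h) \tsum_(u ⊗ v <- comul g)
      (rho (x ⊗ rho (u ⊗ a)) * varsigma (y ⊗ v))
    = \tsum_(x ⊗ y <- comul h) \tsum_(u ⊗ v <- comul g)
      (varsigma (x ⊗ u) * rho ((y * v) ⊗ a)))
  (h19 : forall h g : H,
    varsigma (h ⊗ g)
    = \tsum_(x ⊗ y <- comul h) \tsum_(u ⊗ v <- comul g)
      (varsigma (x ⊗ u) * rho ((y * v) ⊗ (1 : A))))
  (h20 : forall h : H,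
    rho (h ⊗ (1 : A))
    = \tsum_(x ⊗ y <- comul h) \tsum_(u ⊗ v <- comul 1)
      (rho (x ⊗ rho (u ⊗ (1 : A))) * varsigma (y ⊗ v)))
  (h21 : forall h : H,
    rho (h ⊗ (1 : A))
    = \tsum_(u ⊗ v <- comul 1) (rho (u ⊗ (1 : A)) * varsigma (v ⊗ h)))
  (h22 : forall a : A,
    \tsum_(u ⊗ v <- comul (1 : H)) ((a * rho (u ⊗ (1 : A))) ⊗ v)
    = \tsum_(u ⊗ v <- comul (1 : H)) (rho (u ⊗ a) ⊗ v)) :
  exists sigma : {linear btensor (HR H) -> A},
    (forall t : (H ⊗ H)%type, varsigma t = sigma (btensor_proj (HR H) t)) /\
    forall (h g m l : H) (a a' : A), HL H l ->
      (rho (h ⊗ (1 : A)) = rho (PiL h ⊗ (1 : A))) /\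
      (rho (h ⊗ (a * a'))
        = \tsum_(x ⊗ y <- comul h) (rho (x ⊗ a) * rho (y ⊗ a'))) /\
      (rho ((Sinv l * h) ⊗ a) = rho (h ⊗ a) * rho (l ⊗ (1 : A)) /\
        rho ((l * h) ⊗ a) = rho (l ⊗ (1 : A)) * rho (h ⊗ a)) /\
      (rho ((1 : H) ⊗ a) = a) /\
      (sigma ((l * h) ⊗_[HR H] g) = rho (l ⊗ (1 : A)) * sigma (h ⊗_[HR H] g) /\
        sigma ((Sinv l * h) ⊗_[HR H] g) = sigma (h ⊗_[HR H] g) * rho (l ⊗ (1 : A))) /\
      (\tsum_(x ⊗ y <- comul h)
          (rho (x ⊗ rho (l ⊗ (1 : A))) * sigma (y ⊗_[HR H] g))
        = sigma (h ⊗_[HR H] (l * g))) /\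
      (sigma ((1 : H) ⊗_[HR H] h) = rho (h ⊗ (1 : A)) /\
        sigma (h ⊗_[HR H] (1 : H)) = rho (h ⊗ (1 : A))) /\
      (\tsum_(x ⊗ y <- comul h) \tsum_(u ⊗ v <- comul g) \tsum_(p ⊗ q <- comul m)
          (rho (x ⊗ sigma (u ⊗_[HR H] p)) * sigma (y ⊗_[HR H] (v * q)))
        = \tsum_(x ⊗ y <- comul h) \tsum_(u ⊗ v <- comul g)
          (sigma (x ⊗_[HR H] u) * sigma ((y * v) ⊗_[HR H] m))) /\
      (\tsum_(x ⊗ y <- comul h) \tsum_(u ⊗ v <- comul g)
          (rho (x ⊗ rho (u ⊗ a)) * sigma (y ⊗_[HR H] v))
        = \tsum_(x ⊗ y <- comul h) \tsum_(u ⊗ v <- comul g)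
          (sigma (x ⊗_[HR H] u) * rho ((y * v) ⊗ a))).
Proof.
have tw1 h g := h18 h g 1.
have [|sigma sigmaE] := @linear_lquot_lift k _ _ (btensor_rel (HR H)) varsigma.
  move=> _ [h [r [g [Hr ->]]]].
  by rewrite linearB /= (cocycle_balanced h19) // subrr.
have sE h g : sigma (h ⊗_[HR H] g) = varsigma (h ⊗ g) by rewrite sigmaE.
exists sigma; split=> // h g m l a a' Hl.
have [Hr PiLr] := Sinv_HL SK Hl.
(* Since S⁻¹(l) lies in H^R, this reduces both statements about S⁻¹(l) to the rules for H^R. *)
have r1 : rho (l ⊗ (1 : A)) = rho (Sinv l ⊗ (1 : A)).
  by rewrite [RHS](act1_PiL h2 h4 h11 h22) PiLr.
split; first exact: (act1_PiL h2 h4 h11 h22).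
split; first exact: h2.
split; first split.
- by rewrite r1; exact: (act_HR_mul h2 h11 h22).
- exact: (act_HL_mul h2 h4 h11 h22).
split; first exact: h4.
rewrite !sE.
split; first split.
- exact: (cocycle_HL_mul h2 h4 h11 h22 tw1 h19).
- by rewrite r1; exact: (cocycle_HR_mul h2 h11 h22 h19).
split.
  rewrite -(cocycle_mul_HL h2 h4 h11 h22 tw1 h19) //.
  by apply: eq_tlift => x y; rewrite sE.
split; first split.
- by rewrite [RHS]h21 (cocycle_1l h2 h4 h11 h22 tw1 h19).
(* The right side of [h20] is the left expansion of ς(h, 1). *)
- by rewrite h20 [LHS](cocycle_absorbl tw1 h19).
split.
  have := h17 h g m.
  set L := LHS; set R := RHS => LR.
  transitivity L; first by do 3![apply: eq_tlift => ? ?]; rewrite !sE.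
  by rewrite LR; do 2![apply: eq_tlift => ? ?]; rewrite !sE.
have := h18 h g a.
set L := LHS; set R := RHS => LR.
transitivity L; first by do 2![apply: eq_tlift => ? ?]; rewrite !sE.
by rewrite LR; do 2![apply: eq_tlift => ? ?]; rewrite !sE.
Qed.
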